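(* Let $(X_t^f)_{t\ge0}$ be the Ornstein–Uhlenbeck process on $\mathbb{R}^d$, $dX_t^f=-X_t^f\,dt+\sqrt2\,dB_t$, with $X_0^f\sim q_0$ where $q_0$ is a probability density with $\mathsf{KL}(q_0\|q_\infty)<\infty$, $q_\infty$ the density of $\mathcal{N}(0,\mathbf{I}_d)$. Let $q_t$ be the density of $X_t^f$. For $0\le a\le b$ define $$H_a^b:=\int_a^b\int_{\mathbb{R}^d}q_u(x)\,\big\|\nabla\log q_u(x)-\nabla\log q_\infty(x)\big\|^2\,dx\,du=\int_a^b\int_{\mathbb{R}^d}q_u(x)\,\|\nabla\log q_u(x)+x\|^2\,dx\,du.$$ Then for all $0<t\le T$, $$H_t^T\le\frac{e^{-2t}}{1-e^{-2t}}\,H_0^t.$$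
   Context: $B_t$ is standard Brownian motion in $\mathbb{R}^d$, independent of $X_0^f$. Equivalently $X_t^f\overset{d}{=}e^{-t}X_0^f+\sqrt{1-e^{-2t}}\,Z$ with $Z\sim\mathcal{N}(0,\mathbf{I})$ independent of $X_0^f$. *)

(* Defs.v *)
From HB Require Import structures.
From mathcomp Require Import all_boot all_order all_algebra.
From mathcomp Require Import all_classical all_reals all_analysis.
Set Implicit Arguments. Unset Strict Implicit. Unset Printing Implicit Defensive.
Import Order.TTheory GRing.Theory Num.Theory.
Local Open Scope ring_scope.
Local Open Scope classical_set_scope.

(* Points of R^d are d-tuples of reals, with the library's product
   (= Borel) sigma-algebra on n.-tuple R. *)

Section Defs.
Variables (R : realType) (d : nat).
Notation V := (d.-tuple R).

Definition sqnorm (x : V) : R := \sum_(i < d) (tnth x i) ^+ 2.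

Definition shift_coord (x : V) (i : 'I_d) (h : R) : V :=
  [tuple tnth x j + (if j == i then h else 0) | j < d].

Definition partial (f : V -> R) (i : 'I_d) (x : V) : R :=
  derive1 (fun h : R => f (shift_coord x i h)) 0.

Definition is_lebesgue_Rd (mu : {measure set V -> \bar R}) : Prop :=
  forall a b : V, (forall i, tnth a i <= tnth b i) ->
    mu [set x | forall i, tnth a i < tnth x i <= tnth b i] =
    (\prod_(i < d) (tnth b i - tnth a i))%:E.

Definition gauss_dens (s : R) (x : V) : R :=
  (2 * pi * s) `^ (- (d%:R / 2)) * expR (- sqnorm x / (2 * s)).

Definition q_inf (x : V) : R := gauss_dens 1 x.

Definition is_prob_density (mu : {measure set V -> \bar R}) (q : V -> R) : Prop :=
  measurable_fun setT q /\ (forall x, 0 <= q x) /\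
  (\int[mu]_x (q x)%:E = 1)%E.

(* KL(q || p) = int q log (q/p)  (with 0 log 0 = 0, since ln 0 = 0) *)
Definition KL (mu : {measure set V -> \bar R}) (q p : V -> R) : \bar R :=
  (\int[mu]_x (q x * ln (q x / p x))%:E)%E.

(* density of X_t = e^{-t} X_0 + sqrt(1 - e^{-2t}) Z, X_0 ~ q0, Z ~ N(0,I):
   Mehler / Gaussian-convolution formula for t > 0, q0 itself at t = 0 *)
Definition OU_dens (mu : {measure set V -> \bar R}) (q0 : V -> R) (t : R) (x : V) : R :=
  if t == 0 then q0 x else
  fine (\int[mu]_y (q0 y *
     gauss_dens (1 - expR (- (2 * t)))
       [tuple tnth x j - expR (- t) * tnth y j | j < d])%:E)%E.

Definition H_OU (mu : {measure set V -> \bar R}) (q0 : V -> R) (a b : R) : \bar R :=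
  (\int[lebesgue_measure]_(u in `[a, b])
     \int[mu]_x (OU_dens mu q0 u x *
        \sum_(i < d) (partial (fun z => ln (OU_dens mu q0 u z)) i x + tnth x i) ^+ 2)%:E)%E.

End Defs.

(* Main.v *)
(* Let I(u) be the inner integral of [H_OU] (the relative Fisher information of
   q_u). If I(t) <= e^{-2(t-s)} I(s) for 0 < s <= t, then H_t^T <= I(t) / 2 and
   H_0^t >= (e^{2t} - 1) / 2 * I(t), which together are the theorem.

   The contraction is a conditional Jensen inequality. Writing p_t(y, x) for the
   Mehler kernel, D_i = d/dx_i + x_i and A_t = D_i q_t, the i-th summand of I(t)
   is the integral of A_t^2 / q_t. Completing the square in z gives, whatever q0,
     int p_s(y, z) p_r(z, x) dz = p_{s+r}(y, x)  and
     int D_i p_s(y, z) p_r(z, x) dz = e^r D_i p_{s+r}(y, x),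
   so q_{s+r} and e^r A_{s+r} are the averages of q_s and A_s against p_r, and
   Cauchy-Schwarz gives e^{2r} int A_{s+r}^2 / q_{s+r} <= int A_s^2 / q_s. *)

Require Import Defs.
From HB Require Import structures.
From mathcomp Require Import all_boot all_order all_algebra.
From mathcomp Require Import all_classical all_reals all_analysis.
From mathcomp Require Import measurable_realfun ring lra.
Import Order.TTheory GRing.Theory Num.Theory.
Import numFieldNormedType.Exports.
Local Open Scope ring_scope.
Local Open Scope classical_set_scope.

(** * Lebesgue measure on R^d *)

Section density_image.
Context (dT : measure_display) (T : measurableType dT) (R : realType).
Variable mu : {measure set T -> \bar R}.
Variables (g : T -> R) (phi : T -> measurableTypeR R).
Hypotheses (mg : measurable_fun setT g) (g0 : forall x, 0 <= g x).
Hypothesis mphi : measurable_fun setT phi.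

Definition density_image (A : set (measurableTypeR R)) : \bar R :=
  (\int[mu]_(x in phi @^-1` A) (g x)%:E)%E.

Let mpre A : measurable A -> measurable (phi @^-1` A).
Proof. by move=> mA; rewrite -[X in measurable X]setTI; exact: mphi. Qed.

Let density_image0 : density_image set0 = 0%E.
Proof. by rewrite /density_image preimage_set0 integral_set0. Qed.

Let density_image_ge0 A : (0 <= density_image A)%E.
Proof. by apply: integral_ge0 => x _; rewrite lee_fin. Qed.

Let density_image_sigma_additive : semi_sigma_additive density_image.
Proof.
move=> F mF tF mUF; rewrite /density_image preimage_bigcup ge0_integral_bigcup//=.
- apply: is_cvg_ereal_nneg_natsum_cond => n _ _.
  by apply: integral_ge0 => x _; rewrite lee_fin.
- by move=> k; exact: mpre.
- by apply/measurable_EFinP; exact: measurable_funTS.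
- by move=> x _; rewrite lee_fin.
- by apply/trivIsetP => i j _ _ ij; rewrite -preimage_setI;
    move/trivIsetP : tF => /(_ i j I I ij) ->; rewrite preimage_set0.
Qed.

HB.instance Definition _ := isMeasure.Build _ _ _ density_image
  density_image0 density_image_ge0 density_image_sigma_additive.

Import HBNNSimple.

Lemma integral_density_image (f : R -> R) :
    measurable_fun [set: measurableTypeR R] f -> (forall x, 0 <= f x) ->
    (forall a b, a < b ->
       (\int[mu]_(x in phi @^-1` `]a, b]) (g x)%:E = (b - a)%:E)%E) ->
  (\int[mu]_x (g x * f (phi x))%:E = \int[lebesgue_measure]_x (f x)%:E)%E.
Proof.
move=> mf f0 hab.
have leb A : measurable A -> lebesgue_measure A = density_image A.
  apply: lebesgue_measure_unique => _ [[a b] _ <-] /=.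
  rewrite lebesgue_measure_itv/= lte_fin; case: ltP => ab.
    by rewrite /density_image hab.
  by rewrite set_itv_ge ?density_image0// bnd_simp -leNgt.
have mfE : measurable_fun [set: measurableTypeR R] (EFin \o f) by exact/measurable_EFinP.
pose h := nnsfun_approx measurableT mfE.
have cvgh x : EFin \o (h^~ x) @ \oo --> (f x)%:E.
  by apply: (cvg_nnsfun_approx measurableT mfE) => // y _; rewrite lee_fin.
transitivity (limn (fun n => \int[lebesgue_measure]_x (h n x)%:E)%E); last first.
  rewrite -monotone_convergence//.
  - by apply: eq_integral => y _; apply/cvg_lim => //; exact: cvgh.
  - by move=> n; exact/measurable_EFinP/measurable_funP.
  - by move=> n y _; rewrite lee_fin.
  - by move=> y _ m n mn; rewrite lee_fin; exact/lefP/nd_nnsfun_approx.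
have mhphi n : measurable_fun setT (fun x => h n (phi x)).
  by apply: measurableT_comp => //.
transitivity (limn (fun n => \int[mu]_x (g x * h n (phi x))%:E)%E).
  rewrite -monotone_convergence//.
  - apply: eq_integral => y _; apply/esym/cvg_lim => //.
    under eq_fun do rewrite EFinM.
    rewrite EFinM; apply: cvgeZl => //; exact: cvgh.
  - by move=> n; apply/measurable_EFinP; apply: measurable_funM.
  - by move=> n y _; rewrite lee_fin mulr_ge0.
  - move=> y _ m n mn; rewrite lee_fin ler_wpM2l//.
    exact/lefP/nd_nnsfun_approx.
congr (limn _); apply/funext => n.
have mpr k : measurable (h n @^-1` [set k]) by exact: measurable_sfunP.
transitivity (\sum_(k \in range (h n))
    \int[mu]_x (g x * (k * \1_(h n @^-1` [set k]) (phi x)))%:E)%E.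
  rewrite -ge0_integral_fsum//.
  - apply: eq_integral => x _; rewrite {1}fimfunE mulr_fsumr// fsumEFin//.
  - move=> r; apply/measurable_EFinP; apply: measurable_funM => //.
    apply: measurable_funM => //; apply: measurableT_comp => //.
  - move=> r x _; rewrite lee_fin mulr_ge0// -lee_fin EFinM.
    exact: nnfun_muleindic_ge0.
transitivity (\sum_(k \in range (h n))
    \int[lebesgue_measure]_x (k * \1_(h n @^-1` [set k]) x)%:E)%E; last first.
  rewrite -ge0_integral_fsum//.
  - by apply: eq_integral => x _; rewrite fsumEFin// -fimfunE.
  - move=> r; apply/measurable_EFinP; apply: measurable_funM => //.
  - by move=> r x _; rewrite EFinM nnfun_muleindic_ge0.
apply: eq_fsbigr => k kr.
have k0 : 0 <= k by move: kr; rewrite inE => -[x _ <-].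
under eq_integral do rewrite mulrCA EFinM.
rewrite ge0_integralZl_EFin//; last 2 first.
  - by move=> x _; rewrite lee_fin mulr_ge0.
  - by apply/measurable_EFinP; apply: measurable_funM => //; apply: measurableT_comp.
under [RHS]eq_integral do rewrite EFinM.
rewrite ge0_integralZl_EFin//; last first.
  by apply/measurable_EFinP.
congr (_ * _)%E.
rewrite integral_indic//= setIT leb// /density_image [RHS]integral_mkcond.
apply: eq_integral => x _; rewrite patchE indicE.
have -> : (x \in phi @^-1` (h n @^-1` [set k])) = (phi x \in h n @^-1` [set k]).
  by apply/idP/idP; rewrite !inE.
by case: ifP => _; rewrite ?mulr1 ?mulr0.
Qed.

End density_image.

Section lebesgue_Rd.
Context (R : realType) (d : nat).
Notation V := (d.-tuple R).
Variable mu : {measure set V -> \bar R}.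
Hypothesis hmu : is_lebesgue_Rd mu.

Lemma measurable_box (a b : 'I_d -> R) :
  measurable [set x : V | forall i, a i < tnth x i <= b i].
Proof.
rewrite [X in measurable X](_ : _ = \bigcap_(i in [set: 'I_d])
    ((fun x : V => tnth x i) @^-1` `]a i, b i])); last first.
  apply/seteqP; split => x /= h i; first by move=> _; rewrite /= in_itv/=.
  by have := h i I; rewrite /= in_itv.
apply: fin_bigcap_measurable => // i _.
rewrite -[X in measurable X]setTI; apply: measurable_tnth => //.
Qed.

Lemma lebesgue_box (a b : 'I_d -> R) : (forall i, a i <= b i) ->
  mu [set x : V | forall i, a i < tnth x i <= b i] =
  (\prod_(i < d) (b i - a i))%:E.
Proof.
move=> ab; have := hmu [tuple a i | i < d] [tuple b i | i < d].
have ab' i : tnth [tuple a i | i < d] i <= tnth [tuple b i | i < d] i by rewrite !tnth_mktuple.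
move=> /(_ ab'); under eq_bigr do rewrite !tnth_mktuple.
move=> <-; congr (mu _); apply/seteqP; split => x /= h i; have := h i;
  by rewrite !tnth_mktuple.
Qed.

Lemma lebesgue_Rd_sigma_finite : sigma_finite [set: V] mu.
Proof.
exists (fun n : nat => [set x : V | forall i, - n%:R < tnth x i <= n%:R]).
  apply/seteqP; split => // x _.
  exists (Num.truncn (\sum_(i < d) `|tnth x i|)).+1 => //= i.
  have hx : `|tnth x i| < (Num.truncn (\sum_(i < d) `|tnth x i|)).+1%:R.
    apply: le_lt_trans (truncnS_gt _).
    by rewrite (bigD1 i)//= lerDl sumr_ge0.
  by move: hx; rewrite ltr_norml => /andP[-> /ltW ->].
move=> n; split; first exact: measurable_box.
by rewrite lebesgue_box ?ltry// => i; rewrite (@le_trans _ _ 0)// oppr_le0.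
Qed.

Lemma integral_prod_pdf (f : 'I_d -> R -> R) :
    (forall i, measurable_fun [set: measurableTypeR R] (f i)) ->
    (forall i y, 0 <= f i y) ->
    (forall i, \int[lebesgue_measure]_y (f i y)%:E = 1)%E ->
  (\int[mu]_x (\prod_(i < d) f i (tnth x i))%:E = 1)%E.
Proof.
move=> mf f0 f1.
pose F (a b : 'I_d -> R) (k : nat) (i : 'I_d) (y : R) : R :=
  if (i < k)%N then f i y else \1_(`]a i, b i]) y.
have mF a b k i : measurable_fun [set: measurableTypeR R] (F a b k i).
  by rewrite /F; case: (i < k)%N => //; exact: measurable_indic.
have F0 a b k i y : 0 <= F a b k i y by rewrite /F; case: ifP.
have mFt a b k i : measurable_fun [set: V] (fun x => F a b k i (tnth x i)).
  by apply: measurableT_comp; [exact: mF|exact: measurable_tnth].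
have H k : (k <= d)%N -> forall a b : 'I_d -> R, (forall i, a i < b i) ->
    (\int[mu]_x (\prod_(i < d) F a b k i (tnth x i))%:E =
     (\prod_(i < d | (k <= i)%N) (b i - a i))%:E)%E.
  elim: k => [_ a b ab|k IH kd a b ab].
    rewrite -lebesgue_box; last by move=> i; exact: ltW.
    rewrite -[X in mu X]setIT -integral_indic//; last exact: measurable_box.
    apply: eq_integral => x _; congr (_%:E); rewrite indicE.
    have [/set_mem/= xab|] := boolP (x \in _).
      rewrite /F big1// => i _; rewrite indicE mem_set//=.
      by rewrite in_itv/=.
    rewrite notin_setE => /existsNP[i xi]; rewrite /F (bigD1 i)//= indicE memNset ?mul0r//=.
  pose i0 := Ordinal kd.
  pose c := \prod_(i < d | (k < i)%N) (b i - a i).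
  have c0 : 0 < c by apply: prodr_gt0 => i _; rewrite subr_gt0.
  pose g (x : V) := c^-1 * \prod_(i < d | i != i0) F a b k i (tnth x i).
  have mg : measurable_fun setT g.
    apply: measurable_funM => //; under eq_fun do rewrite big_mkcond/=.
    by apply: measurable_prod => i _; case: (i != i0).
  have g0 x : 0 <= g x by rewrite mulr_ge0 ?invr_ge0 ?(ltW c0)//; apply: prodr_ge0.
  have := @integral_density_image _ _ _ mu g (fun x => tnth x i0) mg g0
    (@measurable_tnth _ _ _ i0) (f i0) (mf i0) (f0 i0).
  rewrite f1 => hg.
  transitivity (c%:E * \int[mu]_x (g x * f i0 (tnth x i0))%:E)%E.
    rewrite -ge0_integralZl_EFin ?(ltW c0)//; last 2 first.
    - by move=> x _; rewrite lee_fin mulr_ge0.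
    - apply/measurable_EFinP; apply: measurable_funM => //.
      by apply: measurableT_comp; [exact: mf|exact: measurable_tnth].
    apply: eq_integral => x _; rewrite -EFinM; congr (_%:E).
    rewrite /g -!mulrA mulVKf ?gt_eqF// (bigD1 i0)//= {1}/F ltnSn mulrC.
    congr (_ * _); apply: eq_bigr => i ii0; rewrite /F ltnS leq_eqVlt.
    by rewrite (negbTE (_ : i != k :> nat))// -(inj_eq val_inj).
  rewrite hg ?mule1// => al be albe.
  pose a' i := if i == i0 then al else a i.
  pose b' i := if i == i0 then be else b i.
  have ab' i : a' i < b' i by rewrite /a' /b'; case: ifP.
  have := IH (ltnW kd) a' b' ab'.
  have -> : \prod_(i < d | (k <= i)%N) (b' i - a' i) = (be - al) * c.
    rewrite (bigD1 i0)//= /a' /b' eqxx; congr (_ * _).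
    apply: eq_big => [i|i /andP[_ /negbTE ->]//].
    by rewrite ltn_neqAle andbC (eq_sym k) -(inj_eq val_inj).
  move=> IHk.
  transitivity (c^-1%:E * \int[mu]_x (\prod_(i < d) F a' b' k i (tnth x i))%:E)%E.
    rewrite -ge0_integralZl_EFin ?invr_ge0 ?(ltW c0)//; last 2 first.
    - by move=> x _; rewrite lee_fin prodr_ge0.
    - by apply/measurable_EFinP; apply: measurable_prod => i _; exact: mFt.
    rewrite integral_mkcond; apply: eq_integral => x _.
    rewrite patchE -EFinM (bigD1 i0)//= {1}/F ltnn indicE.
    have -> : (x \in (fun x : V => tnth x i0) @^-1` `]al, be]) =
              (tnth x i0 \in `]a' i0, b' i0]%classic).
      by rewrite /a' /b' eqxx; apply/idP/idP; rewrite !inE.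
    case: ifP => _; last by rewrite mul0r mulr0.
    rewrite mul1r /g; congr ((_ * _)%:E); apply: eq_bigr => i /negbTE ii0.
    by rewrite /F /a' /b' ii0.
  by rewrite IHk -EFinM mulrC mulfK ?gt_eqF.
have := H d (leqnn d) (fun=> 0) (fun=> 1) (fun=> ltr01).
rewrite [X in _ = X%:E -> _]big1 => [<-|i _]; last by rewrite subr0.
by apply: eq_integral => x _; congr (_%:E); apply: eq_bigr => i _; rewrite /F ltn_ord.
Qed.

End lebesgue_Rd.

(** * Gaussian densities *)
Section gaussian.
Context (R : realType) (d : nat).
Notation V := (d.-tuple R).
Implicit Types (v l : R) (f u x m : 'I_d -> R).

Definition gaussf v f : R :=
  (2 * pi * v) `^ (- (d%:R / 2)) * expR (- (\sum_(j < d) f j ^+ 2) / (2 * v)).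

Lemma gauss_dens_mktuple v f : gauss_dens v [tuple f j | j < d] = gaussf v f.
Proof.
rewrite /gauss_dens /gaussf /sqnorm.
by under eq_bigr do rewrite tnth_mktuple.
Qed.

Lemma eq_gaussf v f u : f =1 u -> gaussf v f = gaussf v u.
Proof. by move=> /funext ->. Qed.

Definition gauss_peak v : R := (2 * pi * v) `^ (- (d%:R / 2)).

Lemma gauss_peak_gt0 v : 0 < v -> 0 < gauss_peak v.
Proof. by move=> v0; rewrite powR_gt0// !mulr_gt0// pi_gt0. Qed.

Lemma gaussf_gt0 v f : 0 < v -> 0 < gaussf v f.
Proof. by move=> v0; rewrite mulr_gt0 ?expR_gt0// gauss_peak_gt0. Qed.

Lemma gaussf_ge0 v f : 0 <= gaussf v f.
Proof. by rewrite mulr_ge0 ?expR_ge0// powR_ge0. Qed.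

Lemma gaussf_le v f : 0 < v -> gaussf v f <= gauss_peak v.
Proof.
move=> v0; rewrite -[leRHS]mulr1 ler_wpM2l ?powR_ge0// -expR0 ler_expR.
by rewrite mulNr oppr_le0 divr_ge0 ?sumr_ge0// ?mulr_ge0 ?(ltW v0)// => i _; rewrite sqr_ge0.
Qed.

Lemma norm_coord_gaussf_le v f i : 0 < v ->
  `|f i| * gaussf v f <= (1 + v) * gauss_peak v.
Proof.
move=> v0; rewrite /gaussf -/(gauss_peak v) mulrCA mulrC.
rewrite ler_wpM2r ?(ltW (gauss_peak_gt0 v v0))//.
rewrite mulNr expRN ler_pdivrMr ?expR_gt0//.
have h : f i ^+ 2 / (2 * v) <= (\sum_(j < d) f j ^+ 2) / (2 * v).
  rewrite ler_wpM2r ?invr_ge0 ?mulr_ge0 ?(ltW v0)// (bigD1 i)//= lerDl sumr_ge0// => j _.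
  exact: sqr_ge0.
have {}h : 1 + f i ^+ 2 / (2 * v) <= expR ((\sum_(j < d) f j ^+ 2) / (2 * v)).
  by apply: le_trans (expR_ge1Dx _); rewrite lerD2l.
apply: le_trans (ler_wpM2l _ h); last by rewrite addr_ge0// ltW.
have fv : 0 <= f i ^+ 2 / (2 * v) by rewrite divr_ge0 ?sqr_ge0// mulr_ge0// ltW.
have fv2 : v * (f i ^+ 2 / (2 * v)) = `|f i| ^+ 2 / 2.
  by rewrite real_normK ?num_real//; field; rewrite gt_eqF.
rewrite mulrDl mul1r mulrDr fv2 mulr1; have := sqr_ge0 (`|f i| - 1); nra.
Qed.

Lemma measurable_gaussf (dT : measure_display) (T : measurableType dT) v
    (h : T -> 'I_d -> R) :
    (forall j, measurable_fun [set: T] (fun y => h y j)) ->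
  measurable_fun [set: T] (fun y => gaussf v (h y)).
Proof.
move=> mh; apply: measurable_funM => //.
apply: measurableT_comp => //; apply: measurable_funM => //.
apply: measurableT_comp => //; apply: measurable_sum => j.
exact: measurable_funX.
Qed.

Lemma gaussf_normal_pdf v (z m : 'I_d -> R) : 0 < v ->
  gaussf v (fun j => z j - m j) =
  \prod_(j < d) normal_pdf (m j) (Num.sqrt v) (z j).
Proof.
move=> v0; have sv0 : Num.sqrt v != 0 by rewrite gt_eqF// sqrtr_gt0.
under eq_bigr do rewrite normal_pdfE//.
rewrite big_split/= prodr_const card_ord /gaussf; congr (_ * _).
  rewrite /normal_peak sqr_sqrtr ?(ltW v0)// powRN exprVn; congr (_^-1).
  rewrite [d%:R / 2]mulrC powRrM powR12_sqrt ?mulr_ge0 ?pi_ge0 ?(ltW v0)//.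
  rewrite powR_mulrn ?sqrtr_ge0//; congr (_ ^+ _); congr (Num.sqrt _).
  by rewrite -mulr_natl; ring.
rewrite /normal_fun -expR_sum; congr expR; rewrite sqr_sqrtr ?(ltW v0)//.
rewrite -mulr_suml -sumrN; congr (_ / _); by rewrite mulr_natl.
Qed.

Lemma gaussf_shift v f i l : 0 < v ->
  gaussf v (fun j => f j - (if j == i then l * v else 0)) =
  gaussf v f * expR (l * f i - l ^+ 2 * v / 2).
Proof.
move=> v0; rewrite /gaussf -[RHS]mulrA -expRD; congr (_ * expR _).
rewrite (bigD1 i)//= [X in _ = - X / _ + _](bigD1 i)//= eqxx.
under eq_bigr => j /negbTE -> do rewrite subr0.
by field; rewrite gt_eqF.
Qed.

(* Completing the square in z. *)
Lemma gaussf_mul a b e (z u x : 'I_d -> R) (c := b + e ^+ 2 * a) :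
  0 < a -> 0 < b ->
  gaussf a (fun j => z j - u j) * gaussf b (fun j => x j - e * z j) =
  gaussf c (fun j => x j - e * u j) *
  gaussf (a * b / c) (fun j => z j - (b * u j + a * e * x j) / c).
Proof.
move=> a0 b0; have c0 : 0 < c by rewrite ltr_wpDr// mulr_ge0 ?sqr_ge0// ltW.
have an0 : a != 0 by rewrite gt_eqF.
have bn0 : b != 0 by rewrite gt_eqF.
have cn0 : c != 0 by rewrite gt_eqF.
rewrite /gaussf [LHS]mulrACA [RHS]mulrACA -!expRD.
rewrite -!powRM ?mulr_ge0 ?invr_ge0 ?pi_ge0 ?(ltW a0) ?(ltW b0) ?(ltW c0)//.
congr (_ `^ _ * expR _); first by field.
rewrite !mulNr -!opprD; congr (- _); rewrite !mulr_suml -!big_split/=.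
by apply: eq_bigr => j _; rewrite /c in cn0 *; field; rewrite an0 bn0 cn0.
Qed.

Variable mu : {measure set V -> \bar R}.
Hypothesis hmu : is_lebesgue_Rd mu.

Lemma measurable_gaussf_sub v m :
  measurable_fun setT (fun z : V => gaussf v (fun j => tnth z j - m j)).
Proof.
apply: measurable_gaussf => j; apply: measurable_funB => //.
exact: measurable_tnth.
Qed.

Lemma integral_gaussf v m : 0 < v ->
  (\int[mu]_z (gaussf v (fun j => tnth z j - m j))%:E = 1)%E.
Proof.
move=> v0; under eq_integral do rewrite gaussf_normal_pdf//.
apply: (@integral_prod_pdf _ _ _ hmu
  (fun j => normal_pdf (m j) (Num.sqrt v))) => [i|i y|i].
- exact: measurable_normal_pdf.
- exact: normal_pdf_ge0.
- exact: integral_normal_pdf.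
Qed.

Lemma integrable_gaussf v m : 0 < v ->
  mu.-integrable setT (EFin \o fun z => gaussf v (fun j => tnth z j - m j)).
Proof.
move=> v0; apply/integrableP; split.
  by apply/measurable_EFinP; exact: measurable_gaussf_sub.
under eq_integral do rewrite /= ger0_norm ?gaussf_ge0//.
by rewrite integral_gaussf// ltry.
Qed.

Let gaussf_tilt v m i l (z : V) : 0 < v ->
  gaussf v (fun j => tnth z j - m j) *
    expR (l * (tnth z i - m i) - l ^+ 2 * v / 2) =
  gaussf v (fun j => tnth z j - (m j + (if j == i then l * v else 0))).
Proof.
by move=> v0; rewrite -gaussf_shift//; apply: eq_gaussf => j; rewrite opprD addrA.
Qed.

Let norm_coord_gaussf_tilt v m i (z : V) : 0 < v ->
  `|(tnth z i - m i) * gaussf v (fun j => tnth z j - m j)| <= expR (v / 2) *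
    (gaussf v (fun j => tnth z j - (m j + (if j == i then 1 * v else 0))) +
     gaussf v (fun j => tnth z j - (m j + (if j == i then -1 * v else 0)))).
Proof.
move=> v0; rewrite -!gaussf_tilt// -mulrDr [leRHS]mulrCA normrM [leLHS]mulrC.
rewrite (@ger0_norm _ (gaussf _ _)) ?gaussf_ge0//.
rewrite ler_wpM2l ?gaussf_ge0// mulrDr -!expRD.
set w := tnth z i - m i.
have := expR_ge1Dx w; have := expR_ge1Dx (- w).
have := expR_ge0 w; have := expR_ge0 (- w).
rewrite (_ : v / 2 + (1 * w - _) = w); last by field.
rewrite (_ : v / 2 + (-1 * w - _) = - w); last by field.
by move=> ? ? ? ?; rewrite ler_norml; apply/andP; split; lra.
Qed.

Let measurable_coord_gaussf v m i : measurable_fun setT (fun z : V =>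
  (tnth z i - m i) * gaussf v (fun j => tnth z j - m j)).
Proof.
apply: measurable_funM; last exact: measurable_gaussf_sub.
by apply: measurable_funB => //; exact: measurable_tnth.
Qed.

Lemma integral_norm_coord_gaussf v m i : 0 < v ->
  (\int[mu]_z `|(tnth z i - m i) * gaussf v (fun j => tnth z j - m j)|%:E <=
    (expR (v / 2) * 2)%:E)%E.
Proof.
move=> v0.
pose g l (z : V) := gaussf v (fun j => tnth z j - (m j + (if j == i then l * v else 0))).
apply: (@le_trans _ _
  (\int[mu]_z ((expR (v / 2))%:E * ((g 1%R z)%:E + (g (-1)%R z)%:E))%E)%E).
  apply: ge0_le_integral => //.
  - apply/measurable_EFinP; apply: measurableT_comp => //.
  - apply: measurable_funeM.
    apply: emeasurable_funD; apply/measurable_EFinP; exact: measurable_gaussf_sub.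
  - by move=> z _; rewrite -EFinD -EFinM lee_fin norm_coord_gaussf_tilt.
rewrite ge0_integralZl_EFin ?expR_ge0//; last 2 first.
- by move=> z _; rewrite adde_ge0// lee_fin gaussf_ge0.
- apply: emeasurable_funD; apply/measurable_EFinP; exact: measurable_gaussf_sub.
rewrite ge0_integralD//; last 4 first.
- by move=> z _; rewrite lee_fin gaussf_ge0.
- by apply/measurable_EFinP; exact: measurable_gaussf_sub.
- by move=> z _; rewrite lee_fin gaussf_ge0.
- by apply/measurable_EFinP; exact: measurable_gaussf_sub.
by rewrite !integral_gaussf// -EFinD -EFinM.
Qed.

Lemma integrable_coord_gaussf v m i : 0 < v ->
  mu.-integrable setT (EFin \o fun z =>
    (tnth z i - m i) * gaussf v (fun j => tnth z j - m j)).
Proof.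
move=> v0; apply/integrableP; split.
  by apply/measurable_EFinP; exact: (measurable_coord_gaussf v m i).
by apply: le_lt_trans (integral_norm_coord_gaussf v m i v0) _; rewrite ltry.
Qed.

(* With M the integral below, tilting by l costs
   1 >= 1 + l M - l^2 v / 2 for every l; take l = M / v. *)
Lemma Rintegral_coord_gaussf v m i : 0 < v ->
  \int[mu]_z ((tnth z i - m i) * gaussf v (fun j => tnth z j - m j)) = 0.
Proof.
move=> v0; set M := (LHS).
have ig := integrable_gaussf v m v0; have im := integrable_coord_gaussf v m i v0.
have ig1 : \int[mu]_z gaussf v (fun j => tnth z j - m j) = 1.
  by rewrite /Rintegral integral_gaussf.
have key l : l * M <= l ^+ 2 * v / 2.
  have : \int[mu]_z ((1 - l ^+ 2 * v / 2) * gaussf v (fun j => tnth z j - m j) +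
           l * ((tnth z i - m i) * gaussf v (fun j => tnth z j - m j))) <=
         \int[mu]_z gaussf v (fun j => tnth z j - (m j + (if j == i then l * v else 0))).
    apply: le_Rintegral => //.
    - apply: (@eq_integrable _ _ _ mu _ measurableT (fun z =>
        ((1 - l ^+ 2 * v / 2)%:E * (gaussf v (fun j => tnth z j - m j))%:E +
         l%:E * ((tnth z i - m i) * gaussf v (fun j => tnth z j - m j))%:E)%E)) => //.
      by apply: integrableD => //; apply: integrableZl.
    - exact: integrable_gaussf.
    - move=> z _; rewrite -gaussf_tilt// mulrA -mulrDl mulrC ler_wpM2l ?gaussf_ge0//.
      by have := expR_ge1Dx (l * (tnth z i - m i) - l ^+ 2 * v / 2); lra.
  rewrite RintegralD//.
  - rewrite [X in _ + X <= _]RintegralZl// [X in X + _ <= _]RintegralZl// ig1 -/M mulr1.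
    by rewrite {1}/Rintegral integral_gaussf//=; lra.
  - by apply: (integrableZl measurableT (1 - l ^+ 2 * v / 2) ig).
  - by apply: (integrableZl measurableT l im).
have := key (M / v).
have -> : M / v * M = M ^+ 2 / v by field; rewrite gt_eqF.
have -> : (M / v) ^+ 2 * v / 2 = M ^+ 2 / v / 2 by field; rewrite gt_eqF.
have h0 : 0 <= M ^+ 2 / v by rewrite divr_ge0 ?sqr_ge0// ltW.
move=> h; have /eqP : M ^+ 2 / v = 0 by lra.
by rewrite mulf_eq0 invr_eq0 (gt_eqF v0) orbF sqrf_eq0 => /eqP.
Qed.

End gaussian.

(** * Contraction of weighted squares under averaging *)
Section integral_monotonicity.
Context (dT : measure_display) (T : measurableType dT) (R : realType).
Variable mu : {measure set T -> \bar R}.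
Local Open Scope ereal_scope.

Import HBNNSimple.

(* Dispenses with proving that the inner integral of [H_OU] is measurable in u. *)
Lemma ge0_le_integral_nomeas (D : set T) (f g : T -> \bar R) :
  (forall x, D x -> 0 <= f x) -> (forall x, D x -> f x <= g x) ->
  \int[mu]_(x in D) f x <= \int[mu]_(x in D) g x.
Proof.
move=> f0 fg; rewrite !ge0_integralE//; last first.
  by move=> x Dx; exact: le_trans (f0 x Dx) (fg x Dx).
apply: ge_ereal_sup => _ [h /= hf <-]; apply: ereal_sup_ubound.
exists h => //= x; apply: le_trans (hf x) _.
by rewrite !patchE; case: ifPn => // /set_mem /fg.
Qed.

Lemma le_integral_ge0_nomeas (f g : T -> \bar R) :
  (forall x, 0 <= g x) -> (forall x, f x <= g x) ->
  \int[mu]_x f x <= \int[mu]_x g x.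
Proof.
move=> g0 fg; rewrite [leLHS]integralE.
apply: (@le_trans _ _ (\int[mu]_x f^\+ x)).
  by rewrite -[leRHS]sube0 leeB// integral_ge0.
apply: ge0_le_integral_nomeas => // x _.
by rewrite funeposE ge_max fg g0.
Qed.

End integral_monotonicity.

Lemma measurable_funV_gt0 (dT : measure_display) (T : measurableType dT)
    (R : realType) (f : T -> R) :
    measurable_fun setT f -> (forall x, 0 < f x) ->
  measurable_fun setT (fun x => (f x)^-1).
Proof.
move=> mf f0.
rewrite (_ : (fun x => (f x)^-1) = (fun x => expR (- ln (f x)))).
  apply: measurableT_comp => //; apply: measurableT_comp => //.
  exact: measurableT_comp.
by apply/funext => z; rewrite expRN lnK// posrE.
Qed.

Section contraction.
Context (dT : measure_display) (T : measurableType dT) (R : realType).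
Variable mu : {measure set T -> \bar R}.
Hypothesis sf_mu : sigma_finite setT mu.

Let smu : {sigma_finite_measure set T -> \bar R} :=
  HB.pack_for (SigmaFiniteMeasure.type T R) (Measure.sort mu)
    (isSFinite.Build _ _ _ (Measure.sort mu) (sfinite_measure_sigma_finite sf_mu))
    (isSigmaFinite.Build _ _ _ (Measure.sort mu) sf_mu).

(* Cauchy-Schwarz in linearised form:
   2 l a - l^2 q <= a^2 / q for every l, integrated against P(., x). *)
Lemma weighted_square_contraction (P : T * T -> R) (qs as_ qt at_ : T -> R) (c : R) :
    measurable_fun setT P -> (forall w, 0 <= P w) ->
    (forall z, \int[mu]_x (P (z, x))%:E = 1)%E ->
    measurable_fun setT qs -> measurable_fun setT as_ ->
    (forall z, 0 < qs z) -> (forall x, 0 < qt x) ->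
    (forall x, mu.-integrable setT (fun z => (P (z, x) * qs z)%:E)) ->
    (forall x, \int[mu]_z (P (z, x) * qs z) = qt x) ->
    (forall x, mu.-integrable setT (fun z => (P (z, x) * as_ z)%:E)) ->
    (forall x, \int[mu]_z (P (z, x) * as_ z) = c * at_ x) ->
  (\int[mu]_x (c ^+ 2 * (at_ x ^+ 2 / qt x))%:E <=
   \int[mu]_z (as_ z ^+ 2 / qs z)%:E)%E.
Proof.
move=> mP P0 P1 mqs mas qs0 qt0 iq hq ia ha.
have F0 z : 0 <= as_ z ^+ 2 / qs z by rewrite divr_ge0 ?sqr_ge0// ltW.
have mF : measurable_fun setT (fun z => as_ z ^+ 2 / qs z).
  apply: measurable_funM; first exact: measurable_funX.
  exact: measurable_funV_gt0.
have step x : ((c ^+ 2 * (at_ x ^+ 2 / qt x))%:E <=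
    \int[mu]_z (P (z, x) * (as_ z ^+ 2 / qs z))%:E)%E.
  pose l := c * at_ x / qt x.
  have e : \int[mu]_z (2 * l * (P (z, x) * as_ z) - l ^+ 2 * (P (z, x) * qs z)) =
      c ^+ 2 * (at_ x ^+ 2 / qt x).
    have e1 : \int[mu]_z (2 * l * (P (z, x) * as_ z)) = 2 * l * (c * at_ x).
      by rewrite RintegralZl ?ha//; exact: ia.
    have e2 : \int[mu]_z (l ^+ 2 * (P (z, x) * qs z)) = l ^+ 2 * qt x.
      by rewrite RintegralZl ?hq//; exact: iq.
    rewrite RintegralB//.
    - by rewrite e1 e2 /l; field; rewrite gt_eqF.
    - exact: (integrableZl measurableT (2 * l) (ia x)).
    - exact: (integrableZl measurableT (l ^+ 2) (iq x)).
  have i2 : mu.-integrable setT (fun z =>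
      (2 * l * (P (z, x) * as_ z) - l ^+ 2 * (P (z, x) * qs z))%:E).
    apply: (@integrableB _ _ _ mu _ measurableT
      (fun z => (2 * l * (P (z, x) * as_ z))%:E)
      (fun z => (l ^+ 2 * (P (z, x) * qs z))%:E)).
      exact: (integrableZl measurableT (2 * l) (ia x)).
    exact: (integrableZl measurableT (l ^+ 2) (iq x)).
  rewrite -e /Rintegral fineK; last exact: integrable_fin_num.
  apply: le_integral_ge0_nomeas => z; rewrite lee_fin; first by rewrite mulr_ge0.
  have -> : 2 * l * (P (z, x) * as_ z) - l ^+ 2 * (P (z, x) * qs z) =
      P (z, x) * (2 * l * as_ z - l ^+ 2 * qs z) by ring.
  rewrite ler_wpM2l// ler_pdivlMr//.
  by have := sqr_ge0 (as_ z - l * qs z); lra.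
apply: le_trans (ge0_le_integral_nomeas _ _ _ mu _ _ _ _ (fun x _ => step x)) _.
  by move=> x _; rewrite lee_fin mulr_ge0 ?sqr_ge0// divr_ge0 ?sqr_ge0// ltW.
rewrite (fubini_tonelli (m1 := smu) (m2 := smu) (fun w : T * T =>
  (P (w.2, w.1) * (as_ w.2 ^+ 2 / qs w.2))%:E))/=; last 2 first.
- apply/measurable_EFinP; apply: measurable_funM.
    apply: (measurableT_comp mP).
    exact: (measurable_fun_pair measurable_snd measurable_fst).
  exact: (measurableT_comp mF measurable_snd).
- by move=> w; rewrite lee_fin mulr_ge0.
rewrite le_eqVlt; apply/orP; left; apply/eqP; apply: eq_integral => z _.
under eq_integral do rewrite EFinM.
rewrite ge0_integralZr//; last 3 first.
- apply/measurable_EFinP; exact: measurable_fun_pair2.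
- by move=> x _; rewrite lee_fin.
- by rewrite lee_fin.
by rewrite P1 mul1e.
Qed.

Lemma Rintegral_Fubini (q0 W : T -> R) (K : T * T -> R) (C : R) :
    mu.-integrable setT (EFin \o q0) ->
    measurable_fun setT W -> measurable_fun setT K ->
    (forall y, \int[mu]_z `|K (y, z) * W z|%:E <= C%:E)%E ->
    (forall z, mu.-integrable setT (fun y => (q0 y * K (y, z))%:E)) ->
  mu.-integrable setT (fun z => (W z * \int[mu]_y (q0 y * K (y, z)))%:E) /\
  \int[mu]_z (W z * \int[mu]_y (q0 y * K (y, z))) =
  \int[mu]_y (q0 y * \int[mu]_z (K (y, z) * W z)).
Proof.
move=> iq mW mK hC iK.
have mq0 : measurable_fun setT q0.
  by apply/measurable_EFinP; exact: measurable_int iq.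
have mKy y : measurable_fun setT (fun z => K (y, z) * W z).
  apply: measurable_funM => //; exact: measurable_fun_pair2.
have iKW y : mu.-integrable setT (fun z => (K (y, z) * W z)%:E).
  apply/integrableP; split; first exact/measurable_EFinP.
  by apply: le_lt_trans (hC y) _; rewrite ltry.
pose f (w : T * T) := (q0 w.2 * K (w.2, w.1) * W w.1)%:E.
have mf : measurable_fun setT f.
  apply/measurable_EFinP; apply: measurable_funM.
    apply: measurable_funM; first exact: (measurableT_comp mq0 measurable_snd).
    apply: (measurableT_comp mK).
    exact: (measurable_fun_pair measurable_snd measurable_fst).
  exact: (measurableT_comp mW measurable_fst).
have if_ : (smu \x smu)%E.-integrable setT f.
  apply/(integrable21ltyP _ _ mf).
  apply: (@le_lt_trans _ _ (\int[mu]_y (`|q0 y|%:E * C%:E))%E).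
    apply: ge0_le_integral_nomeas => [y _|y _]; first exact: integral_ge0.
    rewrite /f/=; under eq_integral do rewrite -mulrA normrM EFinM.
    rewrite ge0_integralZl_EFin//.
    - by rewrite lee_wpmul2l// lee_fin.
    - by apply/measurable_EFinP; apply: measurableT_comp.
  have C0 : 0 <= C.
    by rewrite -lee_fin; apply: le_trans (hC point); exact: integral_ge0.
  rewrite ge0_integralZr ?lee_fin//; last first.
    by apply/measurable_EFinP; apply: measurableT_comp.
  have /integrableP[_ /= iq'] := iq.
  have fin : (\int[mu]_y `|q0 y|%:E)%E \is a fin_num.
    by rewrite ge0_fin_numE// integral_ge0.
  by rewrite -(fineK fin) -EFinM ltry.
have eG z : (\int[mu]_y f (z, y) = (W z * \int[mu]_y (q0 y * K (y, z)))%:E)%E.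
  rewrite /f/= EFinM /Rintegral fineK; last exact: integrable_fin_num.
  under eq_integral do rewrite mulrC EFinM.
  by rewrite integralZl.
have eF y : (\int[mu]_z f (z, y) = (q0 y * \int[mu]_z (K (y, z) * W z))%:E)%E.
  rewrite /f/= EFinM /Rintegral fineK; last exact: integrable_fin_num.
  under eq_integral do rewrite -mulrA EFinM.
  by rewrite integralZl.
split.
  have := integrable_fubini_F if_; rewrite /fubini_F.
  by under eq_fun do rewrite eG.
have := Fubini if_.
under eq_integral do rewrite eG.
under [X in _ = X -> _]eq_integral do rewrite eF.
by rewrite /Rintegral => ->.
Qed.

End contraction.

(** * The Ornstein-Uhlenbeck density *)
Section OU.
Context (R : realType) (d : nat).
Notation V := (d.-tuple R).
Implicit Types (s t r h : R) (x y z : V) (i j : 'I_d).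
Variable mu : {measure set V -> \bar R}.
Hypothesis hmu : is_lebesgue_Rd mu.
Variable q0 : V -> R.
Hypothesis hq0 : is_prob_density mu q0.

Let mq0 : measurable_fun setT q0. Proof. by case: hq0. Qed.
Let q0_ge0 y : 0 <= q0 y. Proof. by case: hq0 => _ []. Qed.
Let int_q0 : (\int[mu]_y (q0 y)%:E = 1)%E. Proof. by case: hq0 => _ []. Qed.

Let iq0 : mu.-integrable setT (EFin \o q0).
Proof.
apply/integrableP; split; first exact/measurable_EFinP.
by under eq_integral do rewrite /= ger0_norm//; rewrite int_q0 ltry.
Qed.

Definition ou_var (t : R) : R := 1 - expR (- (2 * t)).

Lemma ou_var_gt0 t : 0 < t -> 0 < ou_var t.
Proof. by move=> t0; rewrite subr_gt0 -expR0 ltr_expR oppr_lt0 mulr_gt0. Qed.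

Lemma ou_varE t : ou_var t = 1 - expR (- t) ^+ 2.
Proof. by rewrite /ou_var -expRM_natl; congr (_ - expR _); rewrite -mulr_natl; ring. Qed.

Definition mehler (t : R) (y x : V) : R :=
  gaussf R d (ou_var t) (fun j => tnth x j - expR (- t) * tnth y j).

(* (d/dx_i + x_i) applied to [mehler t y]. *)
Definition mehler_score (t : R) (i : 'I_d) (y x : V) : R :=
  (tnth x i - (tnth x i - expR (- t) * tnth y i) / ou_var t) * mehler t y x.

Definition ou_q (t : R) (x : V) : R := \int[mu]_y (q0 y * mehler t y x).

Definition ou_score (t : R) (i : 'I_d) (x : V) : R :=
  \int[mu]_y (q0 y * mehler_score t i y x).

Lemma mehler_ge0 t y x : 0 <= mehler t y x.
Proof. exact: gaussf_ge0. Qed.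

Lemma mehler_gt0 t y x : 0 < t -> 0 < mehler t y x.
Proof. by move=> t0; apply: gaussf_gt0; exact: ou_var_gt0. Qed.

Lemma mehler_le t y x : 0 < t -> mehler t y x <= gauss_peak R d (ou_var t).
Proof. by move=> t0; apply: gaussf_le; exact: ou_var_gt0. Qed.

Lemma measurable_mehler2 t : measurable_fun setT (fun w : V * V => mehler t w.1 w.2).
Proof.
apply: measurable_gaussf => j; apply: measurable_funB.
  exact: (measurableT_comp (@measurable_tnth _ _ _ j) measurable_snd).
apply: measurable_funM => //.
exact: (measurableT_comp (@measurable_tnth _ _ _ j) measurable_fst).
Qed.

Lemma measurable_mehler_score2 t i :
  measurable_fun setT (fun w : V * V => mehler_score t i w.1 w.2).
Proof.
have m1 : measurable_fun setT (fun w : V * V => tnth w.2 i).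
  exact: (measurableT_comp (@measurable_tnth _ _ _ i) measurable_snd).
have m2 : measurable_fun setT (fun w : V * V => tnth w.1 i).
  exact: (measurableT_comp (@measurable_tnth _ _ _ i) measurable_fst).
apply: measurable_funM; last exact: measurable_mehler2.
apply: measurable_funB => //; apply: measurable_funM => //.
by apply: measurable_funB => //; exact: measurable_funM.
Qed.

Let integrable_q0M (h : V -> R) (C : R) : measurable_fun setT h ->
  (forall y, `|h y| <= C) -> mu.-integrable setT (fun y => (q0 y * h y)%:E).
Proof.
move=> mh hC.
apply: (@le_integrable _ _ _ mu _ measurableT _ (fun y => (C * q0 y)%:E)).
- by apply/measurable_EFinP; apply: measurable_funM.
- move=> y _; rewrite /= lee_fin !normrM mulrC ler_wpM2r//.
  exact: le_trans (ler_norm _).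
- exact: (integrableZl measurableT C iq0).
Qed.

Let measurable_mehler1 t x : measurable_fun setT (fun y => mehler t y x).
Proof. exact: (measurable_fun_pair1 _ (measurable_mehler2 t)). Qed.

Let measurable_mehler_score1 t i x : measurable_fun setT (fun y => mehler_score t i y x).
Proof. exact: (measurable_fun_pair1 _ (measurable_mehler_score2 t i)). Qed.

Lemma integrable_mehler t x : 0 < t ->
  mu.-integrable setT (fun y => (q0 y * mehler t y x)%:E).
Proof.
move=> t0; apply: (integrable_q0M _ (gauss_peak R d (ou_var t))) => // y.
by rewrite ger0_norm ?mehler_ge0 ?mehler_le.
Qed.

Lemma norm_mehler_coord_le t i x y : 0 < t ->
  `|tnth x i - expR (- t) * tnth y i| * mehler t y x <=
  (1 + ou_var t) * gauss_peak R d (ou_var t).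
Proof.
move=> t0; exact: (norm_coord_gaussf_le _ _ _
  (fun j => tnth x j - expR (- t) * tnth y j) i (ou_var_gt0 t t0)).
Qed.

Lemma norm_mehler_score_le t i x y : 0 < t -> `|mehler_score t i y x| <=
  `|tnth x i| * mehler t y x +
  (ou_var t)^-1 * (`|tnth x i - expR (- t) * tnth y i| * mehler t y x).
Proof.
move=> t0; rewrite normrM (ger0_norm (mehler_ge0 _ _ _)).
rewrite [X in _ <= _ + X]mulrA -mulrDl.
rewrite ler_wpM2r ?mehler_ge0//; apply: le_trans (ler_normB _ _) _.
rewrite lerD2l normrM mulrC ler_wpM2r// normfV gtr0_norm//.
exact: ou_var_gt0.
Qed.

Lemma integrable_mehler_score t i x : 0 < t ->
  mu.-integrable setT (fun y => (q0 y * mehler_score t i y x)%:E).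
Proof.
move=> t0; pose g := gauss_peak R d (ou_var t).
apply: (integrable_q0M _ (`|tnth x i| * g +
   (ou_var t)^-1 * ((1 + ou_var t) * g))) => // y.
apply: le_trans (norm_mehler_score_le t i x y t0) _; apply: lerD.
  by rewrite ler_wpM2l// mehler_le.
by rewrite ler_wpM2l ?invr_ge0 ?(ltW (ou_var_gt0 _ t0))// norm_mehler_coord_le.
Qed.

Lemma OU_densE t x : 0 < t -> OU_dens mu q0 t x = ou_q t x.
Proof.
move=> t0; rewrite /OU_dens (gt_eqF t0); apply: (congr1 fine).
by apply: eq_integral => y _; rewrite gauss_dens_mktuple.
Qed.

Lemma ou_q_gt0 t x : 0 < t -> 0 < ou_q t x.
Proof.
move=> t0; rewrite /ou_q /Rintegral fine_gt0//.
have := integrable_fin_num measurableT (integrable_mehler t x t0).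
rewrite fin_numElt => /andP[_ ->]; rewrite andbT.
rewrite lt0e integral_ge0 ?andbT; last first.
  by move=> y _; rewrite lee_fin mulr_ge0// mehler_ge0.
apply/negP => /eqP e0.
have : (\int[mu]_y `|(q0 y * mehler t y x)%:E| = 0)%E.
  by rewrite -[RHS]e0; apply: eq_integral => y _; rewrite gee0_abs// lee_fin mulr_ge0// mehler_ge0.
move/ae_eq_integral_abs => /(_ measurableT).
have mm : measurable_fun setT (fun y => (q0 y * mehler t y x)%:E).
  by apply/measurable_EFinP; apply: measurable_funM.
move=> /(_ mm) q00.
have : ae_eq mu setT (EFin \o q0) (cst 0%E).
  apply: filterS q00 => y /= /[apply] -[/eqP]; rewrite mulf_eq0.
  by rewrite (gt_eqF (mehler_gt0 t y x t0)) orbF => /eqP ->.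
move=> /ae_eq_integral; rewrite int_q0 integral_cst// mul0e.
by move=> /(_ measurableT _ _)/eqP; rewrite onee_eq0 => /(_ _ _)/negP; apply => //; exact/measurable_EFinP.
Qed.

Lemma ou_varD s r : ou_var r + expR (- r) ^+ 2 * ou_var s = ou_var (s + r).
Proof. by rewrite !ou_varE opprD expRD; ring. Qed.

Let bridge_var s r := ou_var s * ou_var r / ou_var (s + r).

Let bridge_mean s r (y x : V) (j : 'I_d) :=
  (ou_var r * (expR (- s) * tnth y j) + ou_var s * expR (- r) * tnth x j) /
  ou_var (s + r).

Let mehlerM s r y z x : 0 < s -> 0 < r ->
  mehler s y z * mehler r z x = mehler (s + r) y x *
    gaussf R d (bridge_var s r) (fun j => tnth z j - bridge_mean s r y x j).
Proof.
move=> s0 r0.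
have := gaussf_mul R d (ou_var s) (ou_var r) (expR (- r)) (fun j => tnth z j)
  (fun j => expR (- s) * tnth y j) (fun j => tnth x j)
  (ou_var_gt0 s s0) (ou_var_gt0 r r0).
rewrite /= ou_varD => h; rewrite /mehler h; congr (_ * _).
by apply: eq_gaussf => j; rewrite opprD expRD; ring.
Qed.

Let bridge_var_gt0 s r : 0 < s -> 0 < r -> 0 < bridge_var s r.
Proof. by move=> s0 r0; rewrite divr_gt0 ?mulr_gt0 ?ou_var_gt0// addr_gt0. Qed.

Let integral_mehler z r : 0 < r -> (\int[mu]_x (mehler r z x)%:E = 1)%E.
Proof. by move=> r0; apply: integral_gaussf => //; exact: ou_var_gt0. Qed.

Lemma Rintegral_mehlerM s r y x : 0 < s -> 0 < r ->
  \int[mu]_z (mehler s y z * mehler r z x) = mehler (s + r) y x.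
Proof.
move=> s0 r0; have b0 := bridge_var_gt0 s r s0 r0.
under eq_Rintegral do rewrite mehlerM//.
rewrite RintegralZl//; last exact: integrable_gaussf.
by rewrite /Rintegral integral_gaussf//= mulr1.
Qed.

Lemma Rintegral_mehler_scoreM s r i y x : 0 < s -> 0 < r ->
  \int[mu]_z (mehler_score s i y z * mehler r z x) =
  expR r * mehler_score (s + r) i y x.
Proof.
move=> s0 r0; have b0 := bridge_var_gt0 s r s0 r0.
pose m := bridge_mean s r y x; pose v := bridge_var s r.
pose al := 1 - (ou_var s)^-1; pose be := expR (- s) * tnth y i / ou_var s.
pose M := mehler (s + r) y x.
pose g0 (z : V) := gaussf R d v (fun j => tnth z j - m j).
pose g1 (z : V) := (tnth z i - m i) * g0 z.
have ig0 : mu.-integrable setT (EFin \o g0) by exact: integrable_gaussf.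
have ig1 : mu.-integrable setT (EFin \o g1) by exact: integrable_coord_gaussf.
have e z : mehler_score s i y z * mehler r z x =
    (M * al) * g1 z + (M * (al * m i + be)) * g0 z.
  rewrite /mehler_score -mulrA mehlerM// -/M -/(g0 z) /g1 /al /be.
  by rewrite -/v -/m; field; rewrite gt_eqF// ou_var_gt0.
have -> : \int[mu]_z (mehler_score s i y z * mehler r z x) =
    \int[mu]_z ((M * al) * g1 z + (M * (al * m i + be)) * g0 z).
  by apply: eq_Rintegral => z _; rewrite e.
rewrite RintegralD//; last 2 first.
- exact: (integrableZl measurableT (M * al) ig1).
- exact: (integrableZl measurableT (M * (al * m i + be)) ig0).
have -> : \int[mu]_z (M * al * g1 z) = 0.
  by rewrite RintegralZl// /g1 /g0 Rintegral_coord_gaussf ?mulr0.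
have -> : \int[mu]_z (M * (al * m i + be) * g0 z) = M * (al * m i + be).
  by rewrite RintegralZl// /Rintegral /g0 integral_gaussf//= mulr1.
rewrite add0r /mehler_score -/M mulrA mulrC; congr (_ * _).
rewrite /al /be /m /bridge_mean.
have S0 := ou_var_gt0 s s0; have Sr0 := ou_var_gt0 (s + r) (addr_gt0 s0 r0).
have Er : expR r = (expR (- r))^-1 by rewrite expRN invrK.
rewrite Er; move: S0 Sr0; rewrite !ou_varE opprD expRD.
have := expR_gt0 (- r); have := expR_gt0 (- s).
move: (expR (- r)) (expR (- s)) => a b b0' a0 h1 h2.
field; rewrite !gt_eqF//; do ?[apply/andP; split]; rewrite ?gt_eqF//.
Qed.

Lemma is_derive_gaussf_line v (w : 'I_d -> R) i (h : R) : 0 < v ->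
  is_derive h 1 (fun h : R => gaussf R d v (fun j => w j + (if j == i then h else 0)))
    (- (w i + h) / v * gaussf R d v (fun j => w j + (if j == i then h else 0))).
Proof.
move=> v0; have vn0 : v != 0 by rewrite gt_eqF.
have E k : gaussf R d v (fun j => w j + (if j == i then k else 0)) =
    gaussf R d v w * expR (- w i / v * k + (- (2 * v)^-1) * k ^+ 2).
  rewrite (_ : - w i / v * k + _ = (- k / v) * w i - (- k / v) ^+ 2 * v / 2); last by field.
  rewrite -gaussf_shift//; apply: eq_gaussf => j; case: ifP => _; last by rewrite subr0 addr0.
  by rewrite divfK// opprK.
pose p : R -> R := (- w i / v) *: (id : R -> R) + (- (2 * v)^-1) *: ((id : R -> R) ^+ 2).
rewrite (_ : (fun h : R => _) = gaussf R d v w *: (expR \o p)); last first.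
  by apply/funext => k; rewrite E.
rewrite E; move: (gaussf R d v w) => c {E}.
have dp : is_derive h 1 p (- w i / v + - (2 * v)^-1 * (2 * h)).
  have d1 := is_deriveZ (- w i / v) (is_derive_id h (1 : R)).
  have d2 := is_deriveZ (- (2 * v)^-1) (is_deriveX 2 (is_derive_id h (1 : R))).
  apply: (is_derive_eq (is_deriveD d1 d2)).
  rewrite /GRing.scale/=.
  by rewrite !mulr1 expr1.
have de : is_derive h 1 (expR \o p) (expR (p h) * (- w i / v + - (2 * v)^-1 * (2 * h))).
  exact: is_derive1_comp.
have dc := is_deriveZ c de.
apply: (is_derive_eq dc).
rewrite /p /GRing.scale/= !fctE/=.
by field.
Qed.

Lemma partial_ln_OU_dens t i x : 0 < t ->
  partial (fun z => ln (OU_dens mu q0 t z)) i x + tnth x i =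
  ou_score t i x / ou_q t x.
Proof.
move=> t0; have v0 := ou_var_gt0 t t0.
pose w (y : V) j := tnth x j - expR (- t) * tnth y j.
pose G (h : R) (y : V) := gaussf R d (ou_var t) (fun j => w y j + (if j == i then h else 0)).
pose f h y := q0 y * G h y.
have mehlerE h y : mehler t y (shift_coord x i h) = G h y.
  by apply: eq_gaussf => j; rewrite tnth_mktuple /w; ring.
have G0 y : G 0 y = mehler t y x.
  by apply: eq_gaussf => j; rewrite /w; case: ifP => _; rewrite addr0.
have df (h : R) (y : V) : is_derive h 1 (f ^~ y) (q0 y * (- (w y i + h) / ou_var t * G h y)).
  rewrite (_ : f ^~ y = q0 y *: (G ^~ y)); last by apply/funext => k.
  have := is_derive_gaussf_line (ou_var t) (w y) i h v0 => dG.
  exact: is_deriveZ.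
have d1f (h : R) (y : V) : partial1of2 f h y = q0 y * (- (w y i + h) / ou_var t * G h y).
  by rewrite partial1of2E; have [_ ->] := df h y.
pose C := (ou_var t)^-1 * ((1 + ou_var t) * gauss_peak R d (ou_var t)).
have fub h y : `|partial1of2 f h y| <= C * q0 y.
  rewrite d1f normrM (ger0_norm (q0_ge0 y)) mulrC ler_wpM2r// normrM.
  rewrite (ger0_norm (gaussf_ge0 _ _ _ _)) normrM normrN normfV (gtr0_norm v0).
  rewrite mulrAC mulrC ler_wpM2l ?invr_ge0 ?(ltW v0)//.
  have := norm_coord_gaussf_le R d (ou_var t)
    (fun j => w y j + (if j == i then h else 0)) i v0.
  by rewrite /= eqxx.
have intf h : mu.-integrable setT (EFin \o f h).
  have := integrable_mehler t (shift_coord x i h) t0.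
  by rewrite (_ : (fun y => _) = EFin \o f h)//; apply/funext => y; rewrite mehlerE.
have iC : mu.-integrable setT (EFin \o (fun y => C * q0 y)).
  exact: (integrableZl measurableT C iq0).
have C0 : 0 <= C.
  rewrite mulr_ge0 ?invr_ge0 ?(ltW v0)// mulr_ge0//.
    exact: addr_ge0 ler01 (ltW v0).
  exact: (ltW (gauss_peak_gt0 _ _ _ v0)).
have I0 : (`]-1, 1[%classic : set R) 0 by rewrite /= in_itv/= oppr_lt0 ltr01.
have dF := @derivable_under_integral R _ V mu f setT measurableT 0 (-1) 1 I0
  (fun h _ => intf h) (fun h y _ _ => @ex_derive _ _ _ _ _ _ _ (df h y))
  (fun y => C * q0 y) (fun y => mulr_ge0 C0 (q0_ge0 y)) iC (fun h y _ _ => fub h y).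
have vF := @differentiation_under_integral R _ V mu f setT measurableT 0 (-1) 1 I0
  (fun h _ => intf h) (fun h y _ _ => @ex_derive _ _ _ _ _ _ _ (df h y))
  (fun y => C * q0 y) (fun y => mulr_ge0 C0 (q0_ge0 y)) iC (fun h y _ _ => fub h y).
set F := (fun h : R => \int[mu]_(y in setT) f h y) in dF vF.
have FE h : F h = OU_dens mu q0 t (shift_coord x i h).
  by rewrite (OU_densE t _ t0) /F /ou_q; apply: eq_Rintegral => y _; rewrite mehlerE.
have F0 : F 0 = ou_q t x by apply: eq_Rintegral => y _; rewrite /f G0.
have qx0 := ou_q_gt0 t x t0.
move: F dF vF FE F0 => F dF vF FE F0.
have dlnF : is_derive (0 : R) 1 (@ln R \o F : R -> R) ((ou_q t x)^-1 * F^`()%classic 0).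
  apply: is_derive1_comp; first by rewrite F0; exact: is_derive1_ln.
  by rewrite derive1E; exact: (DeriveDef dF erefl).
rewrite /partial (_ : (fun h : R => _) = @ln R \o F); last first.
  by apply/funext => h; rewrite /= FE.
rewrite derive1E; have [_ ->] := dlnF; rewrite vF.
pose k y := q0 y * (- w y i / ou_var t * mehler t y x).
have -> : \int[mu]_(y in setT) ((partial1of2 f)^~ y) 0 = \int[mu]_y k y.
  by apply: eq_Rintegral => y _; rewrite d1f addr0 G0.
have im := integrable_mehler t x t0.
have ik : mu.-integrable setT (EFin \o k).
  apply: (integrable_q0M _ C).
    apply: measurable_funM => //; apply: measurable_funM => //.
    apply: measurableT_comp => //; apply: measurable_funB => //.
    by apply: measurable_funM => //; exact: measurable_tnth.
  move=> y; rewrite normrM (ger0_norm (mehler_ge0 _ _ _)) normrM normrN.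
  rewrite normfV (gtr0_norm v0) mulrAC mulrC ler_wpM2l ?invr_ge0 ?(ltW v0)//.
  exact: norm_mehler_coord_le.
have -> : ou_score t i x = tnth x i * ou_q t x + \int[mu]_y k y.
  rewrite /ou_q -RintegralZl// -RintegralD//.
  - apply: eq_Rintegral => y _; rewrite /mehler_score /k -/(w y i).
    by field; rewrite gt_eqF.
  - exact: (integrableZl measurableT (tnth x i) im).
by field; rewrite gt_eqF.
Qed.

Let norm_mehler_score_mehler_le s r i x y z : 0 < s -> 0 < r ->
  `|mehler_score s i y z * mehler r z x| <=
  (expR r * (`|tnth x i| * gauss_peak R d (ou_var r) +
     (1 + ou_var r) * gauss_peak R d (ou_var r))) * mehler s y z +
  ((ou_var s)^-1 * gauss_peak R d (ou_var r)) *
    `|(tnth z i - expR (- s) * tnth y i) * mehler s y z|.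
Proof.
move=> s0 r0; rewrite normrM [`|mehler r z x|]ger0_norm ?mehler_ge0//.
apply: le_trans (ler_wpM2r (mehler_ge0 _ _ _) (norm_mehler_score_le s i z y s0)) _.
rewrite mulrDl; apply: lerD; last first.
  rewrite normrM [`|mehler s y z|]ger0_norm ?mehler_ge0// [leRHS]mulrAC.
  rewrite ler_wpM2l ?mehler_le// mulr_ge0 ?invr_ge0 ?(ltW (ou_var_gt0 s s0))//.
  by rewrite mulr_ge0// mehler_ge0.
rewrite mulrAC ler_wpM2r ?mehler_ge0//.
have zx : `|tnth z i| = expR r * `|tnth x i - (tnth x i - expR (- r) * tnth z i)|.
  rewrite opprB addrCA subrr addr0 normrM ger0_norm ?expR_ge0// mulrA -expRD.
  by rewrite subrr expR0 mul1r.
rewrite zx -mulrA ler_wpM2l ?expR_ge0//.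
apply: le_trans (ler_wpM2r (mehler_ge0 _ _ _) (ler_normB _ _)) _.
rewrite mulrDl lerD ?norm_mehler_coord_le//.
by rewrite ler_wpM2l// mehler_le.
Qed.

Let ou_q_step s r x : 0 < s -> 0 < r ->
  mu.-integrable setT (fun z => (mehler r z x * ou_q s z)%:E) /\
  \int[mu]_z (mehler r z x * ou_q s z) = ou_q (s + r) x.
Proof.
move=> s0 r0.
have [||H1 H2] := Rintegral_Fubini _ V R mu (lebesgue_Rd_sigma_finite _ _ _ hmu)
  q0 (fun z => mehler r z x) (fun w => mehler s w.1 w.2)
  (gauss_peak R d (ou_var r)) iq0 (measurable_mehler1 r x) (measurable_mehler2 s).
- move=> y /=.
  apply: (@le_trans _ _ (\int[mu]_z ((gauss_peak R d (ou_var r))%:E * (mehler s y z)%:E))%E).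
    apply: ge0_le_integral_nomeas => // z _; rewrite -EFinM lee_fin.
    rewrite ger0_norm; last by rewrite mulr_ge0 ?mehler_ge0.
    by rewrite [leLHS]mulrC ler_wpM2r ?mehler_ge0 ?mehler_le.
  rewrite ge0_integralZl_EFin//.
  + by rewrite integral_mehler// mule1.
  + by move=> z _; rewrite lee_fin mehler_ge0.
  + by apply/measurable_EFinP; exact: (measurable_fun_pair2 _ (measurable_mehler2 s)).
  + exact: (ltW (gauss_peak_gt0 _ _ _ (ou_var_gt0 r r0))).
- by move=> z; exact: integrable_mehler.
split; first exact: H1.
apply: (etrans H2); rewrite /ou_q; apply: eq_Rintegral => y _.
apply: (congr1 (fun k => q0 y * k)); exact: Rintegral_mehlerM.
Qed.

Let ou_score_step s r i x : 0 < s -> 0 < r ->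
  mu.-integrable setT (fun z => (mehler r z x * ou_score s i z)%:E) /\
  \int[mu]_z (mehler r z x * ou_score s i z) = expR r * ou_score (s + r) i x.
Proof.
move=> s0 r0; have v0 := ou_var_gt0 s s0.
pose C1 := expR r * (`|tnth x i| * gauss_peak R d (ou_var r) +
     (1 + ou_var r) * gauss_peak R d (ou_var r)).
pose C2 := (ou_var s)^-1 * gauss_peak R d (ou_var r).
have pk := gauss_peak_gt0 R d _ (ou_var_gt0 r r0).
have C10 : 0 <= C1.
  rewrite mulr_ge0 ?expR_ge0// addr_ge0// mulr_ge0// ?(ltW pk)//.
  exact: addr_ge0 ler01 (ltW (ou_var_gt0 r r0)).
have C20 : 0 <= C2 by rewrite mulr_ge0 ?invr_ge0 ?(ltW v0)// ltW.
have mms y : measurable_fun setT (fun z : V => mehler s y z).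
  exact: (measurable_fun_pair2 _ (measurable_mehler2 s)).
have mn y : measurable_fun setT
    (fun z : V => `|(tnth z i - expR (- s) * tnth y i) * mehler s y z|).
  apply: measurableT_comp => //; apply: measurable_funM => //.
  by apply: measurable_funB => //; exact: measurable_tnth.
have [||H1 H2] := Rintegral_Fubini _ V R mu (lebesgue_Rd_sigma_finite _ _ _ hmu)
  q0 (fun z => mehler r z x) (fun w => mehler_score s i w.1 w.2)
  (C1 + C2 * (expR (ou_var s / 2) * 2)) iq0 (measurable_mehler1 r x) (measurable_mehler_score2 s i).
- move=> y /=.
  apply: (@le_trans _ _ (\int[mu]_z (C1%:E * (mehler s y z)%:E +
      C2%:E * `|(tnth z i - expR (- s) * tnth y i) * mehler s y z|%:E))%E).
    apply: ge0_le_integral_nomeas => // z _; rewrite -!EFinM -EFinD lee_fin.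
    exact: norm_mehler_score_mehler_le.
  rewrite ge0_integralD//; last 4 first.
  + by move=> z _; rewrite -EFinM lee_fin mulr_ge0// mehler_ge0.
  + by apply: measurable_funeM; exact/measurable_EFinP.
  + by move=> z _; rewrite -EFinM lee_fin mulr_ge0.
  + by apply: measurable_funeM; exact/measurable_EFinP.
  rewrite EFinD; apply: leeD.
    rewrite ge0_integralZl_EFin//.
    * by rewrite integral_mehler// mule1.
    * by move=> z _; rewrite lee_fin mehler_ge0.
    * exact/measurable_EFinP.
  rewrite ge0_integralZl_EFin//; last exact/measurable_EFinP.
  rewrite [leRHS]EFinM; apply: lee_wpmul2l; first by rewrite lee_fin.
  exact: (integral_norm_coord_gaussf _ _ _ hmu _ (fun j => expR (- s) * tnth y j)).
- by move=> z; exact: integrable_mehler_score.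
split; first exact: H1.
have isr := integrable_mehler_score (s + r) i x (addr_gt0 s0 r0).
apply: (etrans H2); rewrite /ou_score -(RintegralZl _ measurableT isr).
apply: eq_Rintegral => y _; rewrite mulrCA.
apply: (congr1 (fun k => q0 y * k)); exact: Rintegral_mehler_scoreM.
Qed.

Let measurable_of_step (h : V -> R) :
  mu.-integrable setT (fun z => (mehler 1 z [tuple 0 | _ < d] * h z)%:E) ->
  measurable_fun setT h.
Proof.
move=> /measurable_int /measurable_EFinP mh.
rewrite (_ : h = fun z => (mehler 1 z [tuple 0 | _ < d])^-1 *
    (mehler 1 z [tuple 0 | _ < d] * h z)); last first.
  by apply/funext => z; rewrite mulKf// gt_eqF// mehler_gt0.
apply: measurable_funM => //; apply: measurable_funV_gt0 => // z.
exact: mehler_gt0.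
Qed.

Lemma measurable_ou_q s : 0 < s -> measurable_fun setT (ou_q s).
Proof. by move=> s0; apply: measurable_of_step; exact: (ou_q_step s 1 _ s0 ltr01).1. Qed.

Lemma measurable_ou_score s i : 0 < s -> measurable_fun setT (ou_score s i).
Proof. by move=> s0; apply: measurable_of_step; exact: (ou_score_step s 1 i _ s0 ltr01).1. Qed.

Lemma fisher_coord_contraction s r i : 0 < s -> 0 < r ->
  (\int[mu]_x (expR r ^+ 2 * (ou_score (s + r) i x ^+ 2 / ou_q (s + r) x))%:E <=
   \int[mu]_x (ou_score s i x ^+ 2 / ou_q s x)%:E)%E.
Proof.
move=> s0 r0.
apply: (@weighted_square_contraction _ V R mu (lebesgue_Rd_sigma_finite _ _ _ hmu)
  (fun w => mehler r w.1 w.2)).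
- exact: measurable_mehler2.
- by move=> w; exact: mehler_ge0.
- by move=> z; exact: integral_mehler.
- exact: measurable_ou_q.
- exact: measurable_ou_score.
- by move=> z; exact: ou_q_gt0.
- by move=> x; apply: ou_q_gt0; exact: addr_gt0.
- by move=> x; case: (ou_q_step s r x s0 r0).
- by move=> x; case: (ou_q_step s r x s0 r0).
- by move=> x; case: (ou_score_step s r i x s0 r0).
- by move=> x; case: (ou_score_step s r i x s0 r0).
Qed.

Definition fisher (u : R) : \bar R :=
  (\int[mu]_x (OU_dens mu q0 u x *
     \sum_(i < d) (partial (fun z => ln (OU_dens mu q0 u z)) i x + tnth x i) ^+ 2)%:E)%E.

Lemma fisher_sum u : 0 < u ->
  fisher u = (\sum_(i < d) \int[mu]_x (ou_score u i x ^+ 2 / ou_q u x)%:E)%E.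
Proof.
move=> u0; rewrite -ge0_integral_sum//.
- apply: eq_integral => x _; rewrite sumEFin; apply: (congr1 EFin).
  rewrite (OU_densE u x u0) mulr_sumr; apply: eq_bigr => i _.
  rewrite partial_ln_OU_dens//; have := ou_q_gt0 u x u0.
  by move: (ou_score u i x) (ou_q u x) => a b b0; field; rewrite gt_eqF.
- move=> i; apply/measurable_EFinP; apply: measurable_funM.
    by apply: measurable_funX; exact: measurable_ou_score.
  apply: measurable_funV_gt0; first exact: measurable_ou_q.
  by move=> x; exact: ou_q_gt0.
- by move=> i x _; rewrite lee_fin divr_ge0 ?sqr_ge0// ltW// ou_q_gt0.
Qed.

Lemma fisher_ge0 u : 0 <= u -> (0 <= fisher u)%E.
Proof.
move=> u0; apply: integral_ge0 => x _; rewrite lee_fin.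
apply: mulr_ge0; last by apply: sumr_ge0 => i _; exact: sqr_ge0.
have [->|un0] := eqVneq u 0; first by rewrite /OU_dens eqxx.
have up : 0 < u by rewrite lt_neqAle eq_sym un0.
by rewrite (OU_densE u x up) ltW// ou_q_gt0.
Qed.

Lemma fisher_contraction s t : 0 < s -> s <= t ->
  ((expR (2 * (t - s)))%:E * fisher t <= fisher s)%E.
Proof.
move=> s0; rewrite le_eqVlt => /predU1P[->|st].
  by rewrite subrr mulr0 expR0 mul1e.
have t0 := lt_trans s0 st; have r0 : 0 < t - s by rewrite subr_gt0.
rewrite !fisher_sum// ge0_sume_distrr; last first.
  move=> i _; apply: integral_ge0 => x _.
  by rewrite lee_fin divr_ge0 ?sqr_ge0// ltW// ou_q_gt0.
apply: lee_sum => i _; have := fisher_coord_contraction s (t - s) i s0 r0.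
rewrite (_ : s + (t - s) = t); last by ring.
apply: le_trans; rewrite -ge0_integralZl_EFin ?expR_ge0//.
- rewrite le_eqVlt; apply/orP; left; apply/eqP; apply: eq_integral => x _.
  rewrite -EFinM; apply: (congr1 (fun k => (k * _)%:E)).
  by rewrite expRM_natl.
- by move=> x _; rewrite lee_fin divr_ge0 ?sqr_ge0// ltW// ou_q_gt0.
- apply/measurable_EFinP; apply: measurable_funM.
    by apply: measurable_funX; exact: measurable_ou_score.
  apply: measurable_funV_gt0; first exact: measurable_ou_q.
  by move=> x; exact: ou_q_gt0.
Qed.

End OU.

Lemma continuous_exp_decay (R : realType) (t : R) :
  continuous (fun u : R => expR (2 * (t - u))).
Proof.
move=> u; apply: continuous_comp; last exact: continuous_expR.
by apply: cvgM; [exact: cvg_cst|apply: cvgB; [exact: cvg_cst|exact: cvg_id]].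
Qed.

Lemma measurable_exp_decay (R : realType) (t : R) (D : set R) :
  measurable_fun D (fun u : R => expR (2 * (t - u))).
Proof.
by apply: measurable_funTS; apply: continuous_measurable_fun; exact: continuous_exp_decay.
Qed.

Lemma integral_exp_decay (R : realType) (t a b : R) : a <= b ->
  (\int[lebesgue_measure]_(u in `[a, b]) (expR (2 * (t - u)))%:E =
   ((expR (2 * (t - a)) - expR (2 * (t - b))) / 2)%:E)%E.
Proof.
rewrite le_eqVlt => /predU1P[->|ab].
  by rewrite set_itv1 integral_set1 subrr mul0r.
pose F : R -> R := (- 2^-1) *: (fun u : R => expR (2 * (t - u))).
have dF (u : R) : is_derive u 1 F (expR (2 * (t - u))).
  have dp : is_derive u 1 (2 *: (cst t - id) : R -> R) (- 2).
    have d1 := is_deriveZ 2 (is_deriveB (is_derive_cst t u (1 : R)) (is_derive_id u (1 : R))).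
    by apply: (is_derive_eq d1); rewrite /GRing.scale/= sub0r mulrN1.
  have de := is_derive1_comp (is_derive_expR ((2 *: (cst t - id) : R -> R) u)) dp.
  apply: (is_derive_eq (is_deriveZ (- 2^-1) de)).
  by rewrite /GRing.scale/= !fctE; field.
have cF : continuous F.
  by move=> u; apply: differentiable_continuous; apply/derivable1_diffP; case: (dF u).
rewrite (@continuous_FTC2 _ _ F)//.
- have FE u : F u = - 2^-1 * expR (2 * (t - u)) by [].
  by rewrite -EFinB; apply: (congr1 EFin); rewrite !FE; field.
- by apply: continuous_subspaceT; exact: continuous_exp_decay.
- split.
  + by move=> u _; case: (dF u).
  + by apply: cvg_at_right_filter; exact: cF.
  + by apply: cvg_at_left_filter; exact: cF.
- by move=> u _; rewrite derive1E; case: (dF u).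
Qed.

Theorem theorem1 (R : realType) (d : nat)
  (mu : {measure set (d.-tuple R) -> \bar R})
  (hmu : is_lebesgue_Rd mu)
  (q0 : d.-tuple R -> R)
  (hq0 : is_prob_density mu q0)
  (hKL : (KL mu q0 (@q_inf R d) < +oo)%E)
  (t T : R) (ht : 0 < t) (htT : t <= T) :
  (H_OU mu q0 t T <=
     (expR (- (2 * t)) / (1 - expR (- (2 * t))))%:E * H_OU mu q0 0 t)%E.
Proof.
pose I := fisher R d mu q0.
have I0 u : 0 <= u -> (0 <= I u)%E by exact: fisher_ge0.
have It0 := I0 t (ltW ht).
have upper : (H_OU mu q0 t T <= 2^-1%:E * I t)%E.
  apply: (@le_trans _ _
    (\int[lebesgue_measure]_(u in `[t, T]) ((expR (2 * (t - u)))%:E * I t))%E).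
    apply: ge0_le_integral_nomeas => u /=; rewrite in_itv/= => /andP[tu _].
      exact: I0 (le_trans (ltW ht) tu).
    have := fisher_contraction R d mu hmu q0 hq0 t u ht tu.
    rewrite -/I => h.
    have := lee_wpmul2l (_ : 0 <= (expR (2 * (t - u)))%:E)%E h.
    rewrite muleA -EFinM -expRD -mulrDr addrA subrK subrr mulr0 expR0 mul1e.
    by apply; rewrite lee_fin expR_ge0.
  rewrite ge0_integralZr//; last first.
    by apply/measurable_EFinP; exact: measurable_exp_decay.
  rewrite integral_exp_decay// lee_wpmul2r// lee_fin subrr mulr0 expR0.
  by have := expR_ge0 (2 * (t - T)); lra.
have lower : (((expR (2 * t) - 1) / 2)%:E * I t <= H_OU mu q0 0 t)%E.
  apply: (@le_trans _ _ (\int[lebesgue_measure]_(u in `[0%R, t])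
    (((fun u => (expR (2 * (t - u)))%:E * I t) \_ `]0%R, t]) u))%E); last first.
    apply: ge0_le_integral_nomeas => u /=; rewrite in_itv/= => /andP[u0 ut].
      by rewrite patchE; case: ifPn => // _; rewrite mule_ge0// lee_fin expR_ge0.
    rewrite patchE; case: ifPn => [/set_mem/=|_]; last exact: I0.
    rewrite in_itv/= => /andP[up _].
    exact: fisher_contraction.
  rewrite -integral_mkcondr (_ : _ `&` _ = `]0, t]%classic); last first.
    by rewrite setIidr//; exact: subset_itv_oc_cc.
  rewrite integral_itv_obnd_cbnd; last first.
    apply: emeasurable_funM => //.
    by apply/measurable_EFinP; exact: measurable_exp_decay.
  rewrite ge0_integralZr//; last first.
    by apply/measurable_EFinP; exact: measurable_exp_decay.
  by rewrite integral_exp_decay ?(ltW ht)// subr0 subrr mulr0 expR0.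
have e1 : expR (- (2 * t)) < 1 by rewrite -expR0 ltr_expR oppr_lt0 mulr_gt0.
apply: le_trans upper _.
have c0 : 0 <= expR (- (2 * t)) / (1 - expR (- (2 * t))).
  by rewrite divr_ge0 ?expR_ge0// subr_ge0 ltW.
apply: le_trans (lee_wpmul2l _ lower); last by rewrite lee_fin.
rewrite muleA -EFinM (_ : _ * _ = 2^-1)//.
have -> : expR (2 * t) = (expR (- (2 * t)))^-1 by rewrite expRN invrK.
move: (expR_gt0 (- (2 * t))) e1; move: (expR (- (2 * t))) => a a0 a1.
by field; rewrite (gt_eqF a0) gt_eqF// subr_gt0.
Qed.
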